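(* Let $n\ge1$ and let $(u_i,v_i)\in[0,1]^2$, $i=1,\dots,n$, be a sample. Then $$n\,\bar\omega^2_2=\frac{1}{4n}\sum_{i,j=1}^n(1-|u_i-u_j|)(1-|v_i-v_j|)-\frac12\sum_{i=1}^n\left(u_i^2-u_i-\tfrac12\right)\left(v_i^2-v_i-\tfrac12\right)+\frac n9 .$$
   Context: Here $d=2$. A corner of $[0,1]^2$ is a function $c:\{0,1\}\to\{\mathrm{true},\mathrm{false}\}$; there are $4$ corners. For a corner $c$ and $x\in[0,1]^2$, let $\mathrm{cornerLe}(c,x)=\{s\in[0,1]^2:\ \text{for all }k,\ s_k\ge x_k\text{ if }c(k)=\mathrm{true},\ s_k\le x_k\text{ if }c(k)=\mathrm{false}\}$. For the sample $X_i=(u_i,v_i)$ put $F_n^c(x)=\frac1n\sum_{i=1}^n\mathbf 1\{X_i\in\mathrm{cornerLe}(c,x)\}$, and $F^c(x)=\prod_{k=0}^{1}g_k(x)$ with $g_k(x)=1-x_k$ if $c(k)=\mathrm{true}$ and $g_k(x)=x_k$ otherwise. Define $\omega^2_c=\int_{[0,1]^2}(F_n^c(x)-F^c(x))^2\,dx$ and $\bar\omega^2_2=\frac14\sum_c\omega^2_c$ (sum over the four corners). *)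

(* Defs.v *)
From mathcomp Require Import all_boot all_order all_algebra.
From mathcomp Require Import all_classical all_reals all_analysis.

Set Implicit Arguments.
Unset Strict Implicit.
Unset Printing Implicit Defensive.

Import Order.TTheory GRing.Theory Num.Theory.
Import numFieldNormedType.Exports.

Local Open Scope classical_set_scope.
Local Open Scope ring_scope.

Definition point_coord (R : realType) (x : R * R) (k : 'I_2) : R :=
  if k == ord0 then x.1 else x.2.

Definition unit_square (R : realType) : set (R * R) := `[0, 1] `*` `[0, 1].

Definition corner := {ffun 'I_2 -> bool}.

Definition cornerLe (R : realType) (c : corner) (x : R * R) : set (R * R) :=
  [set s | unit_square s /\
    forall k : 'I_2,
      if c k then point_coord x k <= point_coord s k else point_coord s k <= point_coord x k].

Definition corner_ecdf (R : realType) (n : nat) (X : 'I_n -> R * R)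
    (c : corner) (x : R * R) : R :=
  n%:R^-1 * \sum_(i < n) \1_(cornerLe c x) (X i).

Definition corner_cdf (R : realType) (c : corner) (x : R * R) : R :=
  \prod_(k < 2) (if c k then 1 - point_coord x k else point_coord x k).

(* The integrand is bounded and measurable on the unit square, so the integral
   is finite and the real-valued [Rintegral] loses no information. *)
Definition omega2_corner (R : realType) (n : nat) (X : 'I_n -> R * R)
    (c : corner) : R :=
  \int[(lebesgue_measure \x lebesgue_measure)%E]_(x in @unit_square R)
    (corner_ecdf X c x - corner_cdf c x) ^+ 2.

Definition omega2_bar (R : realType) (n : nat) (X : 'I_n -> R * R) : R :=
  4^-1 * \sum_(c : corner) omega2_corner X c.

(* Main.v *)
(* Write the deviation F_n^c(x) - F^c(x) as one sum over n + 1 terms of products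
   a_k(x_0) b_k(x_1): for each sample point the two half-line indicators with
   weight 1/n, and the two coordinate factors of F^c with weight -1.  Squaring
   and applying Fubini, omega^2_c becomes a double sum of products of
   one-dimensional integrals over [0,1].  Each such integral depends on a single
   bit of the corner c, so the sum over the four corners factors into two sums
   over one bit; these equal 1 - |u_i - u_j|, -(u_i^2 - u_i - 1/2) and 2/3. *)
Require Import Defs.
From mathcomp Require Import all_boot all_order all_algebra.
From mathcomp Require Import all_classical all_reals all_analysis.
From mathcomp Require Import measurable_realfun ring lra.

Import Order.TTheory GRing.Theory Num.Theory.
Import numFieldNormedType.Exports.

Local Open Scope classical_set_scope.
Local Open Scope ring_scope.

(** * Fubini for products of two one-variable functions *)

Section tensor_product.
Context d1 d2 (T1 : measurableType d1) (T2 : measurableType d2) (R : realType).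
Context (m1 : {sigma_finite_measure set T1 -> \bar R}).
Context (m2 : {sigma_finite_measure set T2 -> \bar R}).
Variables (A : set T1) (B : set T2) (f : T1 -> R) (g : T2 -> R).
Hypotheses (mA : measurable A) (mB : measurable B).
Hypotheses (intf : m1.-integrable A (EFin \o f))
           (intg : m2.-integrable B (EFin \o g)).

(** Both factors are extended by zero, so that Fubini can be applied on the whole product space and
    restricted to the rectangle through [hE]. *)
Let h (z : T1 * T2) : \bar R := ((f \_ A) z.1 * (g \_ B) z.2)%:E.

Let hE : (fun z => (f z.1 * g z.2)%:E) \_ (A `*` B) = h.
Proof.
apply/funext => -[x y]; rewrite /h !patchE in_setX/=.
by case: (x \in A); case: (y \in B); rewrite ?mulr0 ?mul0r.
Qed.

Let intfA : m1.-integrable setT (EFin \o (f \_ A)).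
Proof. by rewrite -restrict_EFin; apply/(integrable_mkcond _ mA). Qed.

Let intgB : m2.-integrable setT (EFin \o (g \_ B)).
Proof. by rewrite -restrict_EFin; apply/(integrable_mkcond _ mB). Qed.

Let mh : measurable_fun [set: T1 * T2] h.
Proof.
apply/measurable_EFinP; apply: measurable_funM.
  apply: (measurableT_comp _ measurable_fst).
  by apply/measurable_EFinP; exact: measurable_int intfA.
apply: (measurableT_comp _ measurable_snd).
by apply/measurable_EFinP; exact: measurable_int intgB.
Qed.

(** By Tonelli the iterated integral of the absolute value splits into the two L1 norms, both
    finite. *)
Let inth : (m1 \x m2)%E.-integrable [set: T1 * T2] h.
Proof.
apply/integrable12ltyP; first exact: mh.
under eq_integral => x _.
  rewrite /h/=; under eq_integral do rewrite normrM EFinM.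
  rewrite integralZl//; last exact: integrable_norm intgB.
  over.
set c := (\int[m2]_y `|(g \_ B) y|%:E)%E.
have cfin : c \is a fin_num.
  by apply: integrable_fin_num => //; exact: integrable_norm intgB.
rewrite -(fineK cfin) integralZr//; last exact: integrable_norm intfA.
rewrite lte_mul_pinfty ?ltry ?integral_ge0//.
by apply: integrable_fin_num => //; exact: integrable_norm intfA.
Qed.

Lemma integrable_tensor :
  (m1 \x m2)%E.-integrable (A `*` B) (fun z => (f z.1 * g z.2)%:E).
Proof. by apply/integrable_mkcond; [exact: measurableX|rewrite hE]. Qed.

Lemma Rintegral_tensor :
  \int[(m1 \x m2)%E]_(z in A `*` B) (f z.1 * g z.2) =
  (\int[m1]_(x in A) f x) * (\int[m2]_(y in B) g y).
Proof.
rewrite {1}/Rintegral integral_mkcond hE -(integral12_prod_meas1 inth).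
under eq_integral => x _.
  rewrite /h /fubini_F/=; under eq_integral do rewrite EFinM.
  rewrite integralZl//; over.
rewrite !(Rintegral_mkcond _ A) !(Rintegral_mkcond _ B) /Rintegral.
have gfin := integrable_fin_num measurableT intgB.
by rewrite -{1}(fineK gfin) integralZr// fineM// integrable_fin_num.
Qed.
End tensor_product.

Lemma Rintegral_sum d (T : measurableType d) (R : realType)
    (mu : {measure set T -> \bar R}) (D : set T) (mD : measurable D)
    (I : Type) (s : seq I) (F : I -> T -> R) :
  (forall i, mu.-integrable D (EFin \o F i)) ->
  \int[mu]_(x in D) (\sum_(i <- s) F i x) =
  \sum_(i <- s) \int[mu]_(x in D) F i x.
Proof.
move=> intF; elim: s => [|i s IH].
  rewrite big_nil; under eq_Rintegral do rewrite big_nil.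
  by rewrite Rintegral_cst// mul0r.
rewrite big_cons -IH -RintegralD//.
  by apply: eq_Rintegral => x _; rewrite big_cons.
rewrite (_ : _ \o _ = fun x => \sum_(i <- s) (F i x)%:E)%E; last first.
  by apply/funext => x /=; rewrite sumEFin.
by apply: integrable_sum => // j _; exact: intF.
Qed.

(** Phrased with the derivative of [P], so that each later integral only asks for an antiderivative.
    The case [a = b] is split off because the FTC used needs [a < b]; it occurs when a sample
    coordinate is 0 or 1. *)
Lemma Rintegral_horner (R : realType) (P : {poly R}) (a b : R) : a <= b ->
  \int[lebesgue_measure]_(x in `[a, b]) (P^`()).[x] = P.[b] - P.[a].
Proof.
rewrite le_eqVlt => /predU1P[->|ab].
  by rewrite set_itv1 Rintegral_set1 subrr.
rewrite /Rintegral (continuous_FTC2 (F := horner P) ab)//.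
- by apply: continuous_subspaceT => x; exact: continuous_horner.
- split => [x _||]; first exact: derivable_horner.
  + by apply: cvg_at_right_filter; exact: continuous_horner.
  + by apply: cvg_at_left_filter; exact: continuous_horner.
- by move=> x _; rewrite derivE.
Qed.

(** * One-dimensional integrals over [0,1] *)

Section corner1.
Context {R : realType}.
Notation mu := (@lebesgue_measure R).

(** One coordinate of the [cornerLe] condition, seen as a function of the corner point with the
    sample coordinate fixed; hence [true] gives the ray to the left of [u]. *)
Definition halfline (b : bool) (u : R) : R -> R :=
  \1_(if b then `]-oo, u]%classic else `[u, +oo[%classic).

Definition coord_cdf (b : bool) (x : R) : R := if b then 1 - x else x.

Lemma halflineE b u x : halfline b u x = (if b then x <= u else u <= x)%:R.
Proof.
by rewrite /halfline indicE; case: b; rewrite mem_setE in_itv/= ?andbT.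
Qed.

Lemma measurable_halfline D b u : measurable_fun D (halfline b u).
Proof. by apply: measurable_indic; case: b. Qed.

Lemma measurable_coord_cdf D b : measurable_fun D (coord_cdf b).
Proof. by rewrite /coord_cdf; case: b => //; exact: measurable_funB. Qed.

Lemma coord_cdf_itv b x : x \in `[0, 1]%R -> coord_cdf b x \in `[0, 1]%R.
Proof. by case: b; rewrite /coord_cdf !in_itv/= => /andP[x0 x1]; lra. Qed.

Lemma halfline_itv b u x : halfline b u x \in `[0, 1]%R.
Proof. by rewrite halflineE in_itv/= ler0n lern1 leq_b1. Qed.

Lemma integrable_itv01 (f : R -> R) :
    measurable_fun `[(0 : R), 1] f ->
    (forall x, x \in `[0, 1]%R -> f x \in `[0, 1]%R) ->
  mu.-integrable `[0, 1] (EFin \o f).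
Proof.
move=> mf f01; apply: measurable_bounded_integrable => //.
  by rewrite /= lebesgue_measure_itv/= lte_fin ltr01 -EFinB ltry.
exists 1; split=> // M M1 x x01; apply: (le_trans _ (ltW M1)).
by have := f01 _ x01; rewrite in_itv/= => /andP[f0 f1]; rewrite ger0_norm.
Qed.

Lemma integrable_itv01M (f g : R -> R) :
    measurable_fun `[(0 : R), 1] f -> measurable_fun `[(0 : R), 1] g ->
    (forall x, x \in `[0, 1]%R -> f x \in `[0, 1]%R) ->
    (forall x, x \in `[0, 1]%R -> g x \in `[0, 1]%R) ->
  mu.-integrable `[0, 1] (EFin \o (f \* g)).
Proof.
move=> mf mg f01 g01; apply: integrable_itv01; first exact: measurable_funM.
move=> x x01; move: (f01 x x01) (g01 x x01).
by rewrite !in_itv/= => /andP[f0 f1] /andP[g0 g1]; rewrite mulr_ge0 ?mulr_ile1.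
Qed.

(** The indicator only cuts the domain down to [0,u] or [u,1]. *)
Lemma Rintegral_halfline_horner b u (P : {poly R}) : u \in `[0, 1]%R ->
  \int[mu]_(x in `[0, 1]) (halfline b u x * (P^`()).[x]) =
  if b then P.[u] - P.[0] else P.[1] - P.[u].
Proof.
rewrite in_itv/= => /andP[u0 u1].
pose S : set R := if b then `]-oo, u]%classic else `[u, +oo[%classic.
transitivity (\int[mu]_(x in `[0, 1] `&` S) (P^`()).[x]).
  rewrite Rintegral_mkcondr; apply: eq_Rintegral => x _.
  rewrite patchE /halfline indicE -/S.
  by case: (x \in S); rewrite ?mul1r ?mul0r.
rewrite /S; case: b {S}; rewrite -Rintegral_horner//; congr (Rintegral _ _ _);
  apply/seteqP; split => x /=; rewrite !in_itv/= ?andbT.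
- by move=> [/andP[-> _] ->].
- by move=> /andP[x0 xu]; rewrite x0 xu (le_trans xu).
- by move=> [/andP[_ ->] ->].
- by move=> /andP[ux x1]; rewrite ux x1 (le_trans u0).
Qed.

(** Two rays of the same direction meet in the ray ending at [w], their minimum or maximum; its
    length within [0,1] comes from the antiderivative ['X]. *)
Lemma Rintegral_halfline2 b u v : u \in `[0, 1]%R -> v \in `[0, 1]%R ->
  \int[mu]_(x in `[0, 1]) (halfline b u x * halfline b v x) =
  if b then Num.min u v else 1 - Num.max u v.
Proof.
move=> u01 v01; pose w := if b then Num.min u v else Num.max u v.
have w01 : w \in `[0, 1]%R.
  by rewrite /w /Num.min /Num.max; case: b {w}; case: ifP.
have := Rintegral_halfline_horner b w 'X w01.
rewrite derivX !hornerX subr0 => E; transitivity (if b then w else 1 - w).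
  rewrite -E; apply: eq_Rintegral => x _.
  rewrite !halflineE hornerC mulr1 -natrM mulnb /w.
  by case: b {w w01 E}; rewrite ?le_min ?ge_max.
by rewrite /w; case: b {w w01 E}.
Qed.

Lemma Rintegral_halfline_coord_cdf b u : u \in `[0, 1]%R ->
  \int[mu]_(x in `[0, 1]) (halfline b u x * coord_cdf b x) =
  if b then u - u ^+ 2 / 2 else (1 - u ^+ 2) / 2.
Proof.
move=> u01.
(* The antiderivative of [coord_cdf b]: x - x^2/2 or x^2/2. *)
pose P : {poly R} := (if b then 'X else 0) + (if b then -1 else 1) / 2 *: 'X^2.
have E := Rintegral_halfline_horner b u P u01.
transitivity (if b then P.[u] - P.[0] else P.[1] - P.[u]).
  rewrite -E; apply: eq_Rintegral => x _; congr (_ * _).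
  rewrite /P derivD derivZ derivXn/= expr1.
  by case: b {P E}; rewrite ?derivX ?deriv0 !hornerE/= /coord_cdf; lra.
by rewrite /P; case: b {P E}; rewrite !hornerE/=; lra.
Qed.

Lemma Rintegral_coord_cdf2 b :
  \int[mu]_(x in `[0, 1]) (coord_cdf b x * coord_cdf b x) = 3^-1.
Proof.
(* The antiderivative of (1-x)^2 or of x^2. *)
pose P : {poly R} := (if b then 'X - 'X^2 else 0) + 3^-1 *: 'X^3.
transitivity (P.[1] - P.[0]).
  rewrite -Rintegral_horner ?ler01//; apply: eq_Rintegral => x _.
  rewrite /P derivD derivZ derivXn/=.
  case: b {P}; rewrite ?derivB ?derivX ?derivXn ?deriv0 !hornerE/= /coord_cdf.
    by lra.
  by lra.
by rewrite /P; case: b {P}; rewrite !hornerE/=; lra.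
Qed.

End corner1.

(** Expanding the square gives a sum over pairs [(k, l)] whose terms are again tensors, with factors
    [f k \* f l] and [g k \* g l]; integrability is therefore asked of these products. *)
Lemma Rintegral_sqr_sum_tensor d1 d2 (T1 : measurableType d1)
    (T2 : measurableType d2) (R : realType)
    (m1 : {sigma_finite_measure set T1 -> \bar R})
    (m2 : {sigma_finite_measure set T2 -> \bar R})
    (A : set T1) (B : set T2) (I : finType) (w : I -> R)
    (f : I -> T1 -> R) (g : I -> T2 -> R) :
    measurable A -> measurable B ->
    (forall k l, m1.-integrable A (EFin \o (f k \* f l))) ->
    (forall k l, m2.-integrable B (EFin \o (g k \* g l))) ->
  \int[(m1 \x m2)%E]_(z in A `*` B) (\sum_k w k * (f k z.1 * g k z.2)) ^+ 2 =
  \sum_k \sum_l w k * w l *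
    ((\int[m1]_(x in A) (f k x * f l x)) * (\int[m2]_(y in B) (g k y * g l y))).
Proof.
move=> mA mB intf intg.
pose F (p : I * I) (z : T1 * T2) :=
  w p.1 * w p.2 * ((f p.1 \* f p.2) z.1 * (g p.1 \* g p.2) z.2).
have mAB : measurable (A `*` B) by exact: measurableX.
have intP p := integrable_tensor _ _ _ _ _ m1 m2 _ _ _ _ mA mB
  (intf p.1 p.2) (intg p.1 p.2).
rewrite pair_big/=.
transitivity (\int[(m1 \x m2)%E]_(z in A `*` B) (\sum_p F p z)).
  apply: eq_Rintegral => z _.
  rewrite expr2 big_distrlr/= pair_big/=; apply: eq_bigr => p _.
  by rewrite /F/=; ring.
rewrite Rintegral_sum//; last first.
  move=> p; have := integrableZl mAB (w p.1 * w p.2) (intP p).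
  by apply: eq_integrable => // z _; rewrite /F/= EFinM.
apply: eq_bigr => p _; rewrite /F RintegralZl//; last exact: intP.
by rewrite Rintegral_tensor.
Qed.

(** * Gram matrix of the coordinate factors and its sum over one bit *)

Section corner_gram.
Context {R : realType}.
Notation mu := (@lebesgue_measure R).

(* [Some u] encodes the indicator at the sample coordinate [u], [None] the
   factor of F^c, so that F_n^c - F^c is a single sum of products. *)
Definition corner_factor (b : bool) (s : option R) : R -> R :=
  oapp (halfline b) (coord_cdf b) s.

Definition corner_gram (b : bool) (s t : option R) : R :=
  \int[mu]_(x in `[0, 1]) (corner_factor b s x * corner_factor b t x).

Lemma integrable_corner_factorM b s t :
  mu.-integrable `[0, 1] (EFin \o (corner_factor b s \* corner_factor b t)).
Proof.
apply: integrable_itv01M.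
- by case: s => [u|]; [exact: measurable_halfline|exact: measurable_coord_cdf].
- by case: t => [u|]; [exact: measurable_halfline|exact: measurable_coord_cdf].
- by case: s => [u|] x x01; [exact: halfline_itv|exact: coord_cdf_itv].
- by case: t => [u|] x x01; [exact: halfline_itv|exact: coord_cdf_itv].
Qed.

Lemma corner_gramC b s t : corner_gram b s t = corner_gram b t s.
Proof. by apply: eq_Rintegral => x _; rewrite mulrC. Qed.

(** The two bits contribute min(u,v) and 1 - max(u,v). *)
Lemma sum_corner_gram_Some u v : u \in `[0, 1]%R -> v \in `[0, 1]%R ->
  \sum_b corner_gram b (Some u) (Some v) = 1 - `|u - v|.
Proof.
move=> u01 v01; rewrite big_bool /corner_gram /corner_factor/=.
rewrite !Rintegral_halfline2//.
case: (leP u v) => [uv|/ltW uv]; last by rewrite ger0_norm ?subr_ge0//; lra.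
by rewrite distrC ger0_norm ?subr_ge0//; lra.
Qed.

Lemma sum_corner_gram_SomeNone u : u \in `[0, 1]%R ->
  \sum_b corner_gram b (Some u) None = - (u ^+ 2 - u - 2^-1).
Proof.
move=> u01; rewrite big_bool.
rewrite !(Rintegral_halfline_coord_cdf _ _ u01 :
  corner_gram _ (Some u) None = _)/=.
by lra.
Qed.

Lemma sum_corner_gram_None : \sum_b corner_gram b None None = 2 / 3.
Proof.
rewrite big_bool !(Rintegral_coord_cdf2 _ : corner_gram _ None None = _)/=.
by lra.
Qed.

End corner_gram.

(** * Sum over the corners and assembly *)

Lemma lift0_ord1 : lift ord0 ord0 = ord_max :> 'I_2.
Proof. exact: val_inj. Qed.

(** Distributivity: a corner is a free choice of one bit per coordinate. *)
Lemma sum_corner_prod (R : comNzRingType) (F G : bool -> R) :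
  \sum_(c : corner) F (c ord0) * G (c ord_max) = (\sum_b F b) * (\sum_b G b).
Proof.
pose H (i : 'I_2) := if i == ord0 then F else G.
transitivity (\sum_(c : {ffun 'I_2 -> bool}) \prod_i H i (c i)).
  by apply: eq_bigr => c _; rewrite big_ord_recl big_ord1 lift0_ord1.
by rewrite -bigA_distr_bigA big_ord_recl big_ord1.
Qed.

(** Index 0, where [unlift ord0] is [None], carries the term of F^c with weight -1; index
    [lift ord0 i] carries sample point [i] with weight 1/n. *)
Lemma corner_deviationE (R : realType) (n : nat) (u v : 'I_n -> R)
    (huv : forall i : 'I_n, unit_square (u i, v i)) (c : corner) (x : R * R) :
  corner_ecdf (fun i => (u i, v i)) c x - corner_cdf c x =
  \sum_(k < n.+1) oapp (fun=> n%:R^-1) (-1) (unlift ord0 k) *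
    (corner_factor (c ord0) (omap u (unlift ord0 k)) x.1 *
     corner_factor (c ord_max) (omap v (unlift ord0 k)) x.2).
Proof.
rewrite big_ord_recl unlift_none/= mulN1r addrC; congr (- _ + _).
  by rewrite /corner_cdf big_ord_recl big_ord1 lift0_ord1.
rewrite /corner_ecdf mulr_sumr; apply: eq_bigr => i _.
rewrite liftK/=; congr (_ * _).
rewrite indicE !halflineE -natrM mulnb; congr (nat_of_bool _)%:R.
apply/idP/andP => [/set_mem[_ h]|[h0 h1]].
  by split; [exact: (h ord0)|exact: (h ord_max)].
apply/mem_set; split=> // k; rewrite /point_coord; case: eqP => [->//|/eqP k0].
suff -> : k = ord_max by [].
by apply/val_inj; case: k k0 => -[|[]].
Qed.

Theorem theorem3p6 (R : realType) (n : nat) (hn : (1 <= n)%N)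
    (u v : 'I_n -> R)
    (huv : forall i : 'I_n, unit_square (u i, v i)) :
  n%:R * omega2_bar (fun i => (u i, v i)) =
    (4 * n%:R)^-1 *
      (\sum_(i < n) \sum_(j < n) (1 - `|u i - u j|) * (1 - `|v i - v j|))
    - 2^-1 *
      (\sum_(i < n) (u i ^+ 2 - u i - 2^-1) * (v i ^+ 2 - v i - 2^-1))
    + n%:R / 9.
Proof.
have u01 i : u i \in `[0, 1]%R by have [] := huv i.
have v01 i : v i \in `[0, 1]%R by have [] := huv i.
pose w (k : 'I_n.+1) : R := oapp (fun=> n%:R^-1) (-1) (unlift ord0 k).
pose s k := omap u (unlift ord0 k); pose t k := omap v (unlift ord0 k).
pose D (p q : option R) := \sum_b corner_gram b p q.
have sumE : \sum_(c : corner) omega2_corner (fun i => (u i, v i)) c =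
    \sum_(k < n.+1) \sum_(l < n.+1) w k * w l * (D (s k) (s l) * D (t k) (t l)).
  transitivity (\sum_(c : corner) \sum_(k < n.+1) \sum_(l < n.+1) w k * w l *
      (corner_gram (c ord0) (s k) (s l) * corner_gram (c ord_max) (t k) (t l))).
    apply: eq_bigr => c _; rewrite -Rintegral_sqr_sum_tensor//; last 2 first.
    - by move=> k l; exact: integrable_corner_factorM.
    - by move=> k l; exact: integrable_corner_factorM.
    by apply: eq_Rintegral => x _; rewrite corner_deviationE.
  (* The corner sum moves innermost, where each Gram factor sees only one bit of [c]. *)
  rewrite exchange_big; apply: eq_bigr => k _.
  rewrite exchange_big; apply: eq_bigr => l _.
  by rewrite -mulr_sumr (sum_corner_prod _ (fun b => corner_gram b (s k) (s l))
    (fun b => corner_gram b (t k) (t l))).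
have DS i j : D (Some (u i)) (Some (u j)) * D (Some (v i)) (Some (v j)) =
    (1 - `|u i - u j|) * (1 - `|v i - v j|) by rewrite /D !sum_corner_gram_Some.
have DN i : D (Some (u i)) None * D (Some (v i)) None =
    (u i ^+ 2 - u i - 2^-1) * (v i ^+ 2 - v i - 2^-1).
  by rewrite /D !sum_corner_gram_SomeNone// mulrNN.
have D0 : D None None = 2 / 3 by exact: sum_corner_gram_None.
have DC p q : D p q = D q p by apply: eq_bigr => b _; exact: corner_gramC.
have n0 : n%:R != 0 :> R by rewrite pnatr_eq0 -lt0n.
rewrite /omega2_bar sumE big_ord_recl big_ord_recl /w /s /t unlift_none/=.
rewrite D0.
(* Row 0 meets [None] first; symmetry brings it to the form of [DN], so it yields the same cross
   terms as column 0. *)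
under eq_bigr => i _ do
  rewrite liftK/= (DC None (Some (u i))) (DC None (Some (v i))) DN.
under [X in _ + X]eq_bigr => i _.
  rewrite big_ord_recl unlift_none liftK/= DN.
  under eq_bigr => j _ do rewrite liftK/= DS.
  rewrite -mulr_sumr; over.
rewrite big_split/= -!mulr_sumr.
set S1 := \sum_(i < n) \sum_(j < n) _; set S2 := \sum_(i < n) _.
(* With the prefactor n/4, the corner entry (2/3)^2 gives n/9, the two equal cross sums of weight
   -1/n give -S2/2, and the sample block of weight 1/n^2 gives S1/(4n). *)
by field; rewrite n0.
Qed.
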